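(* Consider the D-SG iterates $x^{(k+1)}=\mathcal{W}x^{(k)}-\alpha\tilde\nabla F(x^{(k)})$ with constant stepsize $\alpha\in\left(0,\frac{1+\lambda_N^W}{L}\right)$. Let $\rho(\alpha):=\max\{|1-\alpha\mu|,\,|\lambda_N^W-\alpha L|\}$. Then $\rho(\alpha)\in[0,1)$ and for every $k\ge 0$, $$\mathbb{E}\left[\|x^{(k)}-x^\infty\|^2\right]\le \rho(\alpha)^{2k}\|x^{(0)}-x^\infty\|^2+\frac{1-\rho(\alpha)^{2k}}{1-\rho(\alpha)^2}\,\sigma^2\alpha^2 N .$$ As a result, the robustness measure $J_\infty(\alpha):=\frac{1}{\sigma^2N}\limsup_{k\to\infty}\mathrm{Var}(x^{(k)})$ of D-SG satisfies $$J_\infty(\alpha)\le\frac{\alpha^2}{1-\rho(\alpha)^2}.$$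
   Context: Functions: $f_1,\dots,f_N:\mathbb{R}^d\to\mathbb{R}$ are each $\mu$-strongly convex with $L$-Lipschitz gradient ($0<\mu\le L$). $F:\mathbb{R}^{Nd}\to\mathbb{R}$, $F(x_1,\dots,x_N)=\sum_{i=1}^N f_i(x_i)$. Network: $(\mathcal V,\mathcal E)$ is a connected undirected graph on $\{1,\dots,N\}$; $W$ is a symmetric doubly stochastic $N\times N$ matrix with, for $i\ne j$, $W_{ij}>0$ if $(i,j)\in\mathcal E$ and $W_{ij}=0$ otherwise, and $W_{ii}=1-\sum_{j\neq i}W_{ij}>0$. Its eigenvalues are $1=\lambda_1^W>\lambda_2^W\ge\cdots\ge\lambda_N^W>-1$. $\mathcal{W}:=W\otimes I_d$. Iterates: $x^{(k)}=[(x_1^{(k)})^T,\dots,(x_N^{(k)})^T]^T\in\mathbb{R}^{Nd}$, with deterministic $x^{(0)}$; $\tilde\nabla F(x^{(k)})$ stacks the stochastic gradients $\tilde\nabla f_i(x_i^{(k)})=\tilde\nabla f_i(x_i^{(k)},w_i^{(k)})$. Noise: $w_i^{(k)}$ is a random variable independent of all $w_j^{(t)}$ with $t<k$ and of $w_j^{(k)}$, $j\neq i$, and $\mathbb{E}[\tilde\nabla f_i(x_i^{(k)},w_i^{(k)})\,|\,x_i^{(k)}]=\nabla f_i(x_i^{(k)})$, $\mathbb{E}[\|\tilde\nabla f_i(x_i^{(k)},w_i^{(k)})-\nabla f_i(x_i^{(k)})\|^2\,|\,x_i^{(k)}]\le\sigma^2$, with $\sigma>0$ where $J_\infty$ is considered.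 Fixed point: $x^\infty\in\mathbb{R}^{Nd}$ is the unique solution of $(I_{Nd}-\mathcal W)x^\infty+\alpha\nabla F(x^\infty)=0$. For a random vector $X$, $\mathrm{Var}(X)=\mathbb{E}\|X-\mathbb{E}X\|^2$ (trace of the covariance). *)

(* Defs.v *)
From HB Require Import structures.
From mathcomp Require Import all_boot all_order all_algebra.
From mathcomp Require Import all_classical all_reals all_analysis.
From mathcomp.real_closed Require Export mxtens.

Set Implicit Arguments.
Unset Strict Implicit.
Unset Printing Implicit Defensive.

Import Order.TTheory GRing.Theory Num.Theory.
Import numFieldNormedType.Exports.

Local Open Scope classical_set_scope.
Local Open Scope ring_scope.

Section Vectors.
Context {R : realType}.

(* The library norm `|x| on matrices is the sup norm. *)
Definition enorm n (x : 'cV[R]_n) : R := Num.sqrt (\sum_(a < n) x a 0 ^+ 2).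

Definition grad n (f : 'cV[R]_n -> R) (x : 'cV[R]_n) : 'cV[R]_n :=
  \col_(a < n) 'D_(delta_mx a 0) f x.

(* R^(Nd) is 'cV[R]_(N * d); the index (i, a) of [tensmx] sits at position
   i * d + a, so that a stacked vector consists of N consecutive blocks. *)
Definition block N d (x : 'cV[R]_(N * d)) (i : 'I_N) : 'cV[R]_d :=
  \col_(a < d) x (mxtens_index (i, a)) 0.

Definition stack N d (v : 'I_N -> 'cV[R]_d) : 'cV[R]_(N * d) :=
  \col_(p < N * d) v (mxtens_unindex p).1 (mxtens_unindex p).2 0.

Definition separable_sum N d (f : 'I_N -> 'cV[R]_d -> R) (x : 'cV[R]_(N * d)) : R :=
  \sum_(i < N) f i (block x i).

Definition strongly_convex n (mu : R) (f : 'cV[R]_n -> R) : Prop :=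
  @convex_function R 'cV[R]_n setT (fun x => f x - mu / 2 * enorm x ^+ 2).

Definition lipschitz_gradient n (L : R) (f : 'cV[R]_n -> R) : Prop :=
  (forall x, differentiable f x) /\
  (forall x y, enorm (grad f x - grad f y) <= L * enorm (x - y)).

End Vectors.

Section Network.
Context {R : realType}.

Definition connected_graph N (e : rel 'I_N) : Prop :=
  [/\ symmetric e, irreflexive e & forall i j, connect e i j].

Definition doubly_stochastic N (W : 'M[R]_N) : Prop :=
  [/\ forall i j, 0 <= W i j,
      forall i, \sum_(j < N) W i j = 1 &
      forall j, \sum_(i < N) W i j = 1].

Definition mixing_matrix N (e : rel 'I_N) (W : 'M[R]_N) : Prop :=
  [/\ W^T = W,
      doubly_stochastic W,
      forall i j, i != j -> (e i j -> 0 < W i j) /\ (~~ e i j -> W i j = 0) &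
      forall i, W i i = 1 - \sum_(j < N | j != i) W i j /\ 0 < W i i].

(* Eigenvalues listed with multiplicity, in nonincreasing order. *)
Definition eigenvalue_list N (W : 'M[R]_N) (lam : seq R) : Prop :=
  sorted (fun a b => b <= a) lam /\
  char_poly W = \prod_(a <- lam) ('X - a%:P).

End Network.

(* R^n with its Borel sigma-algebra. *)
Definition borel_cV (R : realType) (n : nat) :=
  g_sigma_algebraType (@open 'cV[R]_n).

Section Probability.
Context {R : realType} {dO : measure_display} {Omega : measurableType dO}.
Variable P : probability Omega R.

Definition sigma_gen {dT : measure_display} {T : measurableType dT}
    (X : Omega -> T) : set (set Omega) :=
  preimage_set_system setT X measurable.

(* Z is a version of E[Y | G], for an integrable real random variable Y. *)
Definition is_cond_expectation (G : set (set Omega)) (Y Z : Omega -> R) : Prop :=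
  [/\ P.-integrable setT (EFin \o Y),
      forall B, measurable B -> G (Z @^-1` B),
      P.-integrable setT (EFin \o Z) &
      forall A, G A ->
        (\int[P]_(o in A) (Y o)%:E = \int[P]_(o in A) (Z o)%:E)%E].

(* The Bochner expectation, computed coordinatewise. *)
Definition expectation_cV n (X : Omega -> 'cV[R]_n) : 'cV[R]_n :=
  \col_(a < n) fine 'E_P[fun o => (X o a 0)%R]%E.

Definition variance_cV n (X : Omega -> 'cV[R]_n) : \bar R :=
  'E_P[fun o => (enorm (X o - expectation_cV X) ^+ 2)%R]%E.

Context {N d : nat} {dS : measure_display} {S : 'I_N -> measurableType dS}.

(* The sigma-algebra generated jointly by all w_j^(t) with t < k and all
   w_j^(k) with j <> i. *)
Definition other_noise (w : forall i, nat -> Omega -> S i) (i : 'I_N) (k : nat) :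
    set (set Omega) :=
  <<s [set E | exists j t, ((t < k)%N \/ (t = k /\ j <> i)) /\
                           sigma_gen (w j t) E] >>.

Definition independent_noise (w : forall i, nat -> Omega -> S i) : Prop :=
  (forall i k, measurable_fun setT (w i k)) /\
  (forall i k A E, sigma_gen (w i k) A -> other_noise w i k E ->
     (P (A `&` E) = P A * P E)%E).

Fixpoint dsg (W : 'M[R]_N) (alpha : R)
    (g : forall i, 'cV[R]_d -> S i -> 'cV[R]_d)
    (w : forall i, nat -> Omega -> S i) (x0 : 'cV[R]_(N * d)) (k : nat) (o : Omega)
    : 'cV[R]_(N * d) :=
  if k is k'.+1 then
    let x := dsg W alpha g w x0 k' o in
    tensmx W (1%:M : 'M[R]_d) *m x
      - alpha *: stack (fun i => g i (block x i) (w i k' o))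
  else x0.

(* Conditional mean and conditional variance bound of the stochastic
   gradients g along a random trajectory x, given the current local iterate.
   The conditional mean of a vector is taken coordinatewise. *)
Definition gradient_noise (f : 'I_N -> 'cV[R]_d -> R)
    (g : forall i, 'cV[R]_d -> S i -> 'cV[R]_d)
    (w : forall i, nat -> Omega -> S i)
    (x : nat -> Omega -> 'cV[R]_(N * d)) (sigma : R) : Prop :=
  forall (i : 'I_N) (k : nat),
    let xi := fun o => block (x k o) i in
    let G := sigma_gen (xi : Omega -> borel_cV R d) in
    (forall a : 'I_d,
       is_cond_expectation G (fun o => g i (xi o) (w i k o) a 0)
                             (fun o => grad (f i) (xi o) a 0)) /\
    (exists2 V : Omega -> R,
       is_cond_expectation G
         (fun o => enorm (g i (xi o) (w i k o) - grad (f i) (xi o)) ^+ 2) V &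
       {ae P, forall o, V o <= sigma ^+ 2}).

Definition robustness N' d' (sigma : R) (x : nat -> Omega -> 'cV[R]_(N' * d')) :
    \bar R :=
  (((sigma ^+ 2 * N'%:R)^-1)%:E * limn_esup (fun k => variance_cV (x k)))%E.

End Probability.

Definition rate {R : realType} (mu L lamN alpha : R) : R :=
  Num.max `|1 - alpha * mu| `|lamN - alpha * L|.

(* Main.v *)
(* One step of D-SG is x^(k+1) = T x^(k) - alpha eps^(k), where T = W(x)I - alpha
   grad F fixes x^infty and eps^(k) stacks the gradient errors.  Writing
   w = (1 + lamN)/2 and c = (mu + L)/2,
     T y - T x = (W - w) v - alpha (grad F y - grad F x - c v) + (w - alpha c) v,
   with v = y - x, and the three terms have norm at most (1 - lamN)/2 |v| (spectral
   theorem), alpha (L - mu)/2 |v| (cocoercivity of the gradients) and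
   |w - alpha c| |v|.  These constants add up to rho(alpha), so no Hessian is
   needed.
   The cross term E<T x^(k) - x^infty, eps^(k)> vanishes although the noise is only
   assumed centered given the local iterate x_i^(k): w_i^(k) is independent of the
   whole x^(k), so by Fubini the mean of eps_i^(k) given x^(k) is a function of
   x_i^(k) alone, and that function is almost surely 0.  The variance bound follows
   because the mean minimizes the mean square distance. *)
Require Import Defs.
From HB Require Import structures.
From mathcomp Require Import all_boot all_order all_algebra.
From mathcomp Require Import all_classical all_reals all_analysis.
From mathcomp Require Import measurable_realfun.
From mathcomp.real_closed Require Import complex.
From mathcomp Require Import ring lra.

Import Order.TTheory GRing.Theory Num.Theory.
Import numFieldNormedType.Exports.
Local Open Scope classical_set_scope.
Local Open Scope ring_scope.

Set Implicit Arguments.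
Unset Strict Implicit.
Unset Printing Implicit Defensive.

(** * Quadratic bounds for symmetric matrices *)

Section Spectral.
Local Open Scope sesquilinear_scope.

Lemma normsq_trmxC_mul (C : numClosedFieldType) n (x : 'cV[C]_n) :
  (x ^t* *m x) 0 0 = \sum_i `|x i 0| ^+ 2.
Proof.
rewrite mxE; apply: eq_bigr => i _.
by rewrite !mxE normCK mulrC.
Qed.

Lemma unitarymx_normsq (C : numClosedFieldType) n (U : 'M[C]_n) (x : 'cV[C]_n) :
  U \is unitarymx -> \sum_i `|(U *m x) i 0| ^+ 2 = \sum_i `|x i 0| ^+ 2.
Proof.
move=> Uu; rewrite -!normsq_trmxC_mul trmx_mul map_mxM mulmxA.
by rewrite -[_ *m U]mulmxA -invmx_unitary// mulVmx ?mulmx1// unitarymx_unit.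
Qed.

(** Over the complex numbers [A] is Hermitian, hence diagonalized by a unitary [U]. In the
    coordinates of [U v] the map [A - c] multiplies each entry by an eigenvalue minus [c], and [U]
    preserves sums of squared moduli. The eigenvalues are real, so they are roots of the real
    characteristic polynomial and the hypothesis applies to them. *)
Lemma symmetric_mulmx_bound (R : rcfType) n (A : 'M[R]_n) (c r : R) (v : 'cV[R]_n) :
  A^T = A -> (forall a, root (char_poly A) a -> `|a - c| <= r) ->
  \sum_i ((A *m v - c *: v) i 0) ^+ 2 <= r ^+ 2 * \sum_i (v i 0) ^+ 2.
Proof.
move=> Asym Ac; pose toC := real_complex R.
pose A' := map_mx toC A; pose v' := map_mx toC v.
have A'herm : A' \is hermsymmx.
  apply/is_hermitianmxP; rewrite expr0 scale1r; apply/matrixP => i j.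
  by rewrite !mxE -{1}Asym mxE; apply/esym/CrealP/complex_realP; exists (A j i).
have /hermitian_spectral_diag_real Dreal := A'herm.
have /hermitian_normalmx/orthomx_spectralP := A'herm.
set U := spectralmx A' => A'E.
have Uu : U \is unitarymx by exact: spectral_unitarymx.
have Uunit := unitarymx_unit Uu.
set D := spectral_diag A' in Dreal A'E.
have D_bound i : `|D 0 i - toC c| <= toC r.
  have /complex_realP[s Ds] : D 0 i \is Num.real by exact: (mxOverP Dreal).
  rewrite Ds -rmorphB normc_def /= expr0n addr0 sqrtr_sqr lecR; apply: Ac.
  have : eigenvalue A' (D 0 i).
    (* Row [i] of [U] is a left eigenvector. It is nonzero, since a zero row would make the
       determinant of [U] vanish. *)
    apply/eigenvalueP; exists (row i U).
      rewrite -row_mul A'E !mulmxA mulmxV// mul1mx row_mul.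
      by rewrite row_diag_mx -scalemxAl -rowE.
    apply: contraTneq Uunit => rU0.
    rewrite unitmxE (expand_det_row _ i) big1 ?unitr0// => j _.
    by have /rowP/(_ j) := rU0; rewrite !mxE => ->; rewrite mul0r.
  rewrite eigenvalue_root_char Ds -map_char_poly.
  by rewrite /root horner_map (inj_eq (@complexI R) _ 0).
have UAE : U *m (A' *m v' - toC c *: v') = (diag_mx D - (toC c)%:M) *m (U *m v').
  rewrite mulmxBr A'E !mulmxA mulmxV// mul1mx !mulmxBl mul_scalar_mx.
  by rewrite -scalemxAr -scalemxAl.
have CE m (x : 'cV[R]_m) : (\sum_i x i 0 ^+ 2)%:C%C = \sum_i `|map_mx toC x i 0| ^+ 2.
  rewrite rmorph_sum; apply: eq_bigr => i _; rewrite mxE rmorphXn /=.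
  by rewrite real_normK//; apply/complex_realP; exists (x i 0).
rewrite -lecR rmorphM rmorphXn /= !CE map_mxB map_mxM map_mxZ -/A' -/v'.
rewrite -(unitarymx_normsq _ Uu) UAE -[X in _ <= _ * X](unitarymx_normsq _ Uu).
rewrite mulr_sumr ler_sum// => i _.
rewrite mulmxBl mul_scalar_mx mxE mul_diag_mx !mxE -mulrBl normrM exprMn.
by rewrite ler_wpM2r ?exprn_ge0// lerXn2r ?nnegrE// (le_trans _ (D_bound i)).
Qed.

End Spectral.

(** * Euclidean norm and block vectors *)

Section EuclideanNorm.
Context {R : realType}.

Definition dotv n (x y : 'cV[R]_n) : R := \sum_a x a 0 * y a 0.

Lemma dotvC n (x y : 'cV[R]_n) : dotv x y = dotv y x.
Proof. by apply: eq_bigr => a _; rewrite mulrC. Qed.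

Lemma dotvDl n (x y z : 'cV[R]_n) : dotv (x + y) z = dotv x z + dotv y z.
Proof. by rewrite -big_split; apply: eq_bigr => a _; rewrite mxE mulrDl. Qed.

Lemma dotvZl n k (x y : 'cV[R]_n) : dotv (k *: x) y = k * dotv x y.
Proof. by rewrite mulr_sumr; apply: eq_bigr => a _; rewrite mxE mulrA. Qed.

Lemma dotvNl n (x y : 'cV[R]_n) : dotv (- x) y = - dotv x y.
Proof. by rewrite -scaleN1r dotvZl mulN1r. Qed.

Lemma dotvBl n (x y z : 'cV[R]_n) : dotv (x - y) z = dotv x z - dotv y z.
Proof. by rewrite dotvDl dotvNl. Qed.

Lemma dotvDr n (x y z : 'cV[R]_n) : dotv x (y + z) = dotv x y + dotv x z.
Proof. by rewrite dotvC dotvDl !(dotvC x). Qed.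

Lemma dotvZr n k (x y : 'cV[R]_n) : dotv x (k *: y) = k * dotv x y.
Proof. by rewrite dotvC dotvZl dotvC. Qed.

Lemma dotvNr n (x y : 'cV[R]_n) : dotv x (- y) = - dotv x y.
Proof. by rewrite dotvC dotvNl dotvC. Qed.

Definition dotvE := (dotvDl, dotvDr, dotvNl, dotvNr, dotvZl, dotvZr).

Lemma dotv_ge0 n (x : 'cV[R]_n) : 0 <= dotv x x.
Proof. by apply: sumr_ge0 => a _; rewrite -expr2 sqr_ge0. Qed.

Lemma dotv_eq0 n (x : 'cV[R]_n) : (dotv x x == 0) = (x == 0).
Proof.
apply/idP/eqP => [/eqP x0|->]; last by rewrite /dotv big1// => a _; rewrite mxE mul0r.
apply/colP => a; rewrite mxE; apply/eqP; rewrite -sqrf_eq0 expr2.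
by have /psumr_eq0P := x0; move=> -> // b _; rewrite -expr2 sqr_ge0.
Qed.

Lemma enorm_ge0 n (x : 'cV[R]_n) : 0 <= enorm x.
Proof. exact: sqrtr_ge0. Qed.

Lemma sqr_enorm n (x : 'cV[R]_n) : enorm x ^+ 2 = \sum_a x a 0 ^+ 2.
Proof. by rewrite sqr_sqrtr// sumr_ge0// => a _; rewrite sqr_ge0. Qed.

Lemma sqr_enorm_dotv n (x : 'cV[R]_n) : enorm x ^+ 2 = dotv x x.
Proof. by rewrite sqr_enorm; apply: eq_bigr => a _; rewrite expr2. Qed.

Lemma enormN n (x : 'cV[R]_n) : enorm (- x) = enorm x.
Proof. by congr Num.sqrt; apply: eq_bigr => a _; rewrite mxE sqrrN. Qed.

Lemma enormZ n k (x : 'cV[R]_n) : enorm (k *: x) = `|k| * enorm x.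
Proof.
rewrite /enorm -sqrtr_sqr -sqrtrM ?sqr_ge0//; congr Num.sqrt.
by rewrite mulr_sumr; apply: eq_bigr => a _; rewrite mxE exprMn.
Qed.

Lemma enorm_le n m k (x : 'cV[R]_n) (y : 'cV[R]_m) : 0 <= k ->
  (enorm x <= k * enorm y) = (enorm x ^+ 2 <= k ^+ 2 * enorm y ^+ 2).
Proof.
by move=> k0; rewrite -exprMn ler_pXn2r// nnegrE ?mulr_ge0// enorm_ge0.
Qed.

Lemma dotv_le n (x y : 'cV[R]_n) : dotv x y <= enorm x * enorm y.
Proof.
have [->|y0] := eqVneq y 0.
  by rewrite -(scale0r (0 : 'cV_n)) dotvZr mul0r mulr_ge0 ?enorm_ge0.
rewrite (le_trans (ler_norm _))//.
rewrite -(@ler_pXn2r _ 2)// ?nnegrE ?mulr_ge0 ?enorm_ge0// real_normK ?num_real//.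
rewrite exprMn !sqr_enorm_dotv.
have yy : 0 < dotv y y by rewrite lt_neqAle eq_sym dotv_eq0 y0 dotv_ge0.
(* Cauchy-Schwarz: this square expands to <y,y> (<x,x> <y,y> - <x,y>^2), and <y,y> is positive. *)
have := dotv_ge0 (dotv y y *: x - dotv x y *: y).
rewrite !dotvE (dotvC y x) => h.
rewrite -(ler_pM2l yy) -subr_ge0; apply: le_trans h _.
by rewrite le_eqVlt; apply/orP; left; apply/eqP; ring.
Qed.

Lemma enorm_triangle n (x y : 'cV[R]_n) : enorm (x + y) <= enorm x + enorm y.
Proof.
rewrite -(@ler_pXn2r _ 2)// ?nnegrE ?addr_ge0 ?enorm_ge0//.
rewrite sqrrD !sqr_enorm_dotv !dotvE (dotvC y x).
have := dotv_le x y; lra.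
Qed.

End EuclideanNorm.

Section Blocks.
Context {R : realType} {N d : nat}.
Implicit Types x y : 'cV[R]_(N * d).

Lemma sum_mxtens_index (F : 'I_(N * d) -> R) :
  \sum_p F p = \sum_i \sum_a F (mxtens_index (i, a)).
Proof.
rewrite pair_big /= (reindex (@mxtens_index N d)) /=; last first.
  by exists (@mxtens_unindex N d) => ? _; rewrite (mxtens_indexK, mxtens_unindexK).
by apply: eq_bigr => -[].
Qed.

Lemma sqr_enorm_block x : enorm x ^+ 2 = \sum_i enorm (block x i) ^+ 2.
Proof.
rewrite sqr_enorm sum_mxtens_index; apply: eq_bigr => i _.
by rewrite sqr_enorm; apply: eq_bigr => a _; rewrite mxE.
Qed.

Lemma blockB x y i : block (x - y) i = block x i - block y i.
Proof. by apply/colP => a; rewrite !mxE. Qed.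

Lemma blockZ k x i : block (k *: x) i = k *: block x i.
Proof. by apply/colP => a; rewrite !mxE. Qed.

Lemma block_stack (v : 'I_N -> 'cV[R]_d) i : block (stack v) i = v i.
Proof. by apply/colP => a; rewrite !mxE mxtens_indexK. Qed.

Lemma block_tensmx (W : 'M[R]_N) x i :
  block (tensmx W (1%:M : 'M[R]_d) *m x) i = \sum_j W i j *: block x j.
Proof.
apply/colP => a; rewrite !mxE sum_mxtens_index summxE; apply: eq_bigr => j _.
rewrite (bigD1 a)//= big1 => [|b ba]; last first.
  by rewrite tensmxE mxE eq_sym (negbTE ba) mulr0 mul0r.
by rewrite tensmxE !mxE eqxx mulr1 addr0.
Qed.

End Blocks.

(** * Spectrum of the mixing matrix and its action on stacked vectors *)

Section Mixing.
Context {R : realType} {N : nat}.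
Implicit Type W : 'M[R]_N.

(** Evaluate v W = a v at an index j where |v_j| is largest: |a| |v_j| is at most the sum of |v_k|
    W_kj, hence at most |v_j| because column j sums to 1. *)
Lemma doubly_stochastic_eigenvalue_le1 W a :
  doubly_stochastic W -> root (char_poly W) a -> `|a| <= 1.
Proof.
move=> [W0 _ Wc]; rewrite -eigenvalue_root_char => /eigenvalueP[v vW v0].
have [i vi] : exists i, v 0 i != 0.
  apply/not_existsP => h; case/negP: v0; apply/eqP/rowP => i; rewrite mxE.
  by have /negP := h i; rewrite negbK => /eqP.
have [j _ jmax] := @arg_maxP _ _ _ i xpredT (fun i => `|v 0 i|) isT.
have vj : 0 < `|v 0 j| by apply: lt_le_trans (jmax i isT); rewrite normr_gt0.
rewrite -(ler_pM2r vj) mul1r -normrM.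
have /rowP/(_ j) := vW; rewrite !mxE => <-.
apply: le_trans (ler_norm_sum _ _ _) _.
rewrite -[leRHS]mulr1 -(Wc j) mulr_sumr ler_sum// => k _.
by rewrite normrM (ger0_norm (W0 k j)) ler_wpM2r//; exact: jmax.
Qed.

Lemma eigenvalue_listP W lam : eigenvalue_list W lam ->
  forall a, root (char_poly W) a = (a \in lam).
Proof. by move=> [_ ->] a; rewrite root_prod_XsubC. Qed.

Lemma eigenvalue_list_min W lam : (0 < N)%N -> eigenvalue_list W lam ->
  lam`_N.-1 \in lam /\ forall a, a \in lam -> lam`_N.-1 <= a.
Proof.
move=> N0 [lam_sorted Wlam].
(* The degree of the characteristic polynomial fixes the length, so index [N.-1] is the last entry
   and not the default value of [nth]. *)
have szlam : size lam = N.
  by have := size_char_poly W; rewrite Wlam size_prod_XsubC => -[].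
have N1 : (N.-1 < size lam)%N by rewrite szlam prednK.
split=> [|a /(nthP 0)[k klt <-]]; first exact: mem_nth.
apply: (sorted_leq_nth (leT := fun a b => b <= a)) => //.
- by move=> ? ? ? h1 h2; apply: le_trans h2 h1.
- by rewrite -szlam -ltnS prednK// szlam.
Qed.

(** All eigenvalues lie in [l, 1], that is, within (1 - l)/2 of the midpoint (1 + l)/2. The
    Kronecker product with the identity treats the [d] coordinates separately, so the spectral bound
    is applied, for each [a], to the vector [u] of the [a]-th coordinates of all blocks. *)
Lemma mixing_bound d W lam l (x : 'cV[R]_(N * d)) :
  W^T = W -> doubly_stochastic W -> eigenvalue_list W lam ->
  (forall a, a \in lam -> l <= a) -> l <= 1 ->
  enorm (tensmx W (1%:M : 'M[R]_d) *m x - ((1 + l) / 2) *: x)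
    <= (1 - l) / 2 * enorm x.
Proof.
move=> Wsym Wds Wlam lmin l1.
rewrite enorm_le; last lra.
rewrite !sqr_enorm_block.
under eq_bigr do rewrite blockB blockZ block_tensmx sqr_enorm.
under [in leRHS]eq_bigr do rewrite sqr_enorm.
rewrite exchange_big [in leRHS]exchange_big mulr_sumr ler_sum// => a _.
pose u := \col_i x (mxtens_index (i, a)) 0.
have eig_bound b : root (char_poly W) b -> `|b - (1 + l) / 2| <= (1 - l) / 2.
  move=> rb; have /lmin lb : b \in lam by rewrite -(eigenvalue_listP Wlam).
  have := doubly_stochastic_eigenvalue_le1 Wds rb.
  by rewrite !ler_norml; lra.
have -> : \sum_(i < N) block x i a 0 ^+ 2 = \sum_(i < N) u i 0 ^+ 2.
  by apply: eq_bigr => i _; rewrite !mxE.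
have h := symmetric_mulmx_bound u Wsym eig_bound.
apply: le_trans h; rewrite le_eqVlt; apply/orP; left; apply/eqP.
apply: eq_bigr => i _; rewrite !mxE summxE; congr ((_ - _) ^+ 2).
by apply: eq_bigr => j _; rewrite !mxE.
Qed.

End Mixing.

(** * Contraction of the mean step *)

Section Smooth.
Context {R : realType} {n : nat}.
Implicit Types (f : 'cV[R]_n -> R) (x y v : 'cV[R]_n) (L mu : R).

Lemma derive_grad f x v : differentiable f x -> 'D_v f x = dotv (grad f x) v.
Proof.
move=> df; rewrite deriveE// {1}(matrix_sum_delta v) linear_sum.
apply: eq_bigr => a _; rewrite big_ord1 linearZ /= mxE deriveE//.
by rewrite mulrC.
Qed.

Lemma is_derive_line f x v (t : R) : (forall x, differentiable f x) ->
  is_derive t (1 : R) (fun t : R => f (x + t *: v)) (dotv (grad f (x + t *: v)) v).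
Proof.
move=> df; have dfv : derivable f (x + t *: v) v by exact: diff_derivable.
have E : (fun h : R => h^-1 *: (((fun t : R => f (x + t *: v)) \o shift t) (h *: (1 : R))
                        - f (x + t *: v)))
       = (fun h : R => h^-1 *: ((f \o shift (x + t *: v)) (h *: v) - f (x + t *: v))).
  apply/funext => h /=; congr (_ *: (f _ - _)).
  by rewrite [h *: 1]mulr1 scalerDl addrCA.
apply: DeriveDef; first by rewrite /derivable E.
by rewrite -derive_grad// /derive E.
Qed.

(* With k = 1 and k = -1: the upper and lower quadratic bounds. *)
Lemma descent f L x v k : lipschitz_gradient L f -> `|k| = 1 ->
  k * (f (x + v) - f x - dotv (grad f x) v) <= L / 2 * enorm v ^+ 2.
Proof.
move=> [df Lf] k1.
(* The claim is phi(1) <= phi(0). By the mean value theorem it follows from [dphi] <= 0 on [0, 1],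
   which is Cauchy-Schwarz together with the Lipschitz bound between x + c v and x. *)
pose phi (t : R) := k * (f (x + t *: v) - t * dotv (grad f x) v)
                    - t ^+ 2 * (L / 2 * enorm v ^+ 2).
pose dphi (t : R) := k * (dotv (grad f (x + t *: v)) v - dotv (grad f x) v)
                    - t * (L * enorm v ^+ 2).
have dphiE (t : R) : is_derive t (1 : R) phi (dphi t).
  have h := is_derive_line x v t df.
  apply: is_derive_eq; rewrite /dphi /= /GRing.scale /=.
  by field.
have phiC : {within `[0, 1], continuous phi}.
  apply: continuous_subspaceT => t.
  apply: differentiable_continuous; apply/derivable1_diffP.
  by have [] := dphiE t.
have [c] := MVT_segment ler01 (fun t _ => dphiE t) phiC.
rewrite in_itv /= => /andP[c0 c1].
rewrite subr0 mulr1 /phi scale0r addr0 scale1r expr0n expr1n !mul0r mul1r subr0.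
have : dphi c <= 0.
  rewrite /dphi -dotvBl subr_le0 -dotvZl.
  apply: le_trans (dotv_le _ _) _.
  rewrite enormZ k1 mul1r.
  have := Lf (x + c *: v) x; rewrite addrAC subrr add0r enormZ (ger0_norm c0) => h.
  apply: le_trans (ler_wpM2r (enorm_ge0 v) h) _.
  by rewrite le_eqVlt; apply/orP; left; apply/eqP; ring.
by move=> h1 h2; lra.
Qed.

Lemma descent_le f L x v : lipschitz_gradient L f ->
  f (x + v) <= f x + dotv (grad f x) v + L / 2 * enorm v ^+ 2.
Proof. by move=> Lf; have := descent x v Lf (normr1 R); lra. Qed.

Lemma descent_ge f L x v : lipschitz_gradient L f ->
  f x + dotv (grad f x) v - L / 2 * enorm v ^+ 2 <= f (x + v).
Proof. by move=> Lf; have := descent x v Lf (normrN1 R); lra. Qed.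

(** This is the limit t -> 0 in elementary form. If b < a, the value t = (a - b)/(2m) lies in (0, 1)
    and makes t c smaller than a - b. *)
Lemma ler_add_small (a b c : R) : (forall t : R, 0 < t < 1 -> a <= b + t * c) -> a <= b.
Proof.
move=> h; rewrite leNgt; apply/negP => ba.
pose m := `|c| + (a - b).
have m0 : 0 < m by rewrite /m; have := normr_ge0 c; lra.
have := h ((a - b) / (2 * m)).
rewrite divr_gt0 ?subr_gt0 ?mulr_gt0//= ltr_pdivrMr ?mulr_gt0// mul1r.
have cm : a - b < 2 * m by rewrite /m; have := normr_ge0 c; lra.
move=> /(_ cm); apply/negP; rewrite -ltNge -ltrBDl.
rewrite mulrAC ltr_pdivrMr ?mulr_gt0// ltr_pM2l ?subr_gt0//.
rewrite /m; have := ler_norm c; have := normr_ge0 c; lra.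
Qed.

(** Convexity bounds f(x + t v) from above by its values at x and x + v, and [descent_ge] bounds it
    from below by its linear part. Dividing by t and letting t -> 0 gives the claim. *)
Lemma strongly_convex_ge f L mu x v :
  lipschitz_gradient L f -> strongly_convex mu f ->
  f x + dotv (grad f x) v + mu / 2 * enorm v ^+ 2 <= f (x + v).
Proof.
move=> Lf cf.
(* After division by t, the error of order t has a part mu/2 from the convexity defect t (1 - t) and
   a part L/2 from the quadratic lower bound. *)
apply: (@ler_add_small _ _ ((mu / 2 + L / 2) * enorm v ^+ 2)) => t /andP[t0 t1].
pose T : {i01 R} := Itv01 (ltW t0) (ltW t1).
have := cf T (x + v) x; rewrite !inE => /(_ Logic.I Logic.I).
rewrite convRE /= /conv /= -[unstable.onem t]/(1 - t).
have -> : t *: (x + v) + (1 - t) *: x = x + t *: v.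
  by apply/colP => a; rewrite !mxE; ring.
move=> cxv; rewrite -(ler_pM2l t0); move: cxv.
have := descent_ge x (t *: v) Lf.
rewrite !sqr_enorm_dotv !dotvE (dotvC v x).
lra.
Qed.

(** Here [p] is the gradient increment of the convex function f - mu/2 |.|^2, whose upper quadratic
    bound has constant L - mu. The step length [s] stays free so that the case L = mu can be treated
    too. *)
Lemma gradient_cocoercive f L mu x v s p :
  lipschitz_gradient L f -> strongly_convex mu f ->
  p = grad f (x + v) - grad f x - mu *: v ->
  (2 * s - (L - mu) * s ^+ 2) * dotv p p <= dotv p v.
Proof.
move=> Lf cf pE; pose y := x + v.
have step (u : 'cV[R]_n) (z : 'cV[R]_n) (w : 'cV[R]_n) q :
    z = u + w -> q = grad f z - grad f u - mu *: w ->
    s * dotv q q - (L - mu) / 2 * s ^+ 2 * dotv q q + mu / 2 * dotv w w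
      <= f z - f u - dotv (grad f u) w.
  (* Compare the lower bound at u and the upper bound at z in the point z - s q. *)
  move=> zE qE.
  have := strongly_convex_ge u (w - s *: q) Lf cf.
  have := descent_le z (- (s *: q)) Lf.
  rewrite addrA -zE !sqr_enorm_dotv !dotvE.
  have -> : dotv (grad f z) q = dotv q q + dotv (grad f u) q + mu * dotv w q.
    by rewrite {2}qE !dotvE; ring.
  rewrite (dotvC q w); lra.
(* Adding [step] from x to y and from y to x cancels the function values and leaves the inner
   product of the gradient increment with v. *)
have h1 := step x y v p erefl pE.
have := step y x (- v) (- p) (esym (addrK v x)).
have NpE : - p = grad f x - grad f y - mu *: - v.
  rewrite pE /y; move: (grad f _) (grad f _) => ? ?.
  by apply/colP => a; rewrite !mxE; ring.
move=> /(_ NpE); rewrite !dotvE.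
have -> : dotv p v = dotv (grad f y) v - dotv (grad f x) v - mu * dotv v v.
  by rewrite {1}pE !dotvE.
lra.
Qed.

(** Completing the square turns |p|^2 <= (L - mu) <p,v> into |p - (L - mu)/2 v| <= (L - mu)/2 |v|:
    the point p lies in the ball with diameter from 0 to (L - mu) v. *)
Lemma gradient_sector f L mu x y : mu <= L ->
  lipschitz_gradient L f -> strongly_convex mu f ->
  enorm (grad f y - grad f x - ((mu + L) / 2) *: (y - x))
    <= (L - mu) / 2 * enorm (y - x).
Proof.
move=> muL Lf cf; set v := y - x.
have yE : y = x + v by rewrite addrC subrK.
pose p := grad f y - grad f x - mu *: v.
have cc s : (2 * s - (L - mu) * s ^+ 2) * dotv p p <= dotv p v.
  by apply: (gradient_cocoercive (x := x) _ Lf cf); rewrite -yE.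
have {cc} pv : dotv p p <= (L - mu) * dotv p v.
  have [LE|LN] := eqVneq (L - mu) 0.
    have [->|p0] := eqVneq (dotv p p) 0; first by rewrite LE mul0r.
    (* For L = mu, 2 s |p|^2 <= <p,v> holds for every s, which forces p = 0: this s would give <p,v>
       + 1 <= <p,v>. *)
    have := cc ((dotv p v + 1) / (2 * dotv p p)).
    rewrite LE mul0r subr0.
    have -> : 2 * ((dotv p v + 1) / (2 * dotv p p)) * dotv p p = dotv p v + 1.
      by field.
    lra.
  have L0 : 0 < L - mu by rewrite lt_neqAle eq_sym LN subr_ge0.
  (* The choice s = 1/(L - mu) maximizes 2 s - (L - mu) s^2. *)
  have := cc (L - mu)^-1; rewrite -(ler_pM2l L0).
  have -> : (L - mu) * ((2 * (L - mu)^-1 - (L - mu) * (L - mu)^-1 ^+ 2) * dotv p p)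
    = dotv p p by field.
  by [].
have -> : grad f y - grad f x - ((mu + L) / 2) *: v = p - ((L - mu) / 2) *: v.
  by rewrite /p; apply/colP => a; rewrite !mxE; field.
rewrite enorm_le; last lra.
clearbody p v; rewrite !sqr_enorm_dotv !dotvE (dotvC v p); lra.
Qed.

End Smooth.

Section SeparableSum.
Context {R : realType} {N d : nat}.

(** A move along coordinate (i, a) changes block i only, so the two difference quotients agree as
    functions and have the same limit. *)
Lemma grad_separable_sum (f : 'I_N -> 'cV[R]_d -> R) (x : 'cV[R]_(N * d)) i :
  block (grad (separable_sum f) x) i = grad (f i) (block x i).
Proof.
apply/colP => a; rewrite !mxE /derive.
set u := (X in lim (X @ _)); set v := (X in _ = lim (X @ _)).
suff -> : u = v by [].
apply/funext => h; rewrite {}/u {}/v /=; congr (_ *: _).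
rewrite /separable_sum -sumrB (bigD1 i)//= big1 ?addr0 => [|j ji].
  congr (f i _ - _); apply/colP => b; rewrite !mxE.
  congr (_ * _%:R + _).
  by rewrite !andbT (can_eq (@mxtens_indexK N d)) xpair_eqE eqxx.
have -> : block (h *: delta_mx (mxtens_index (i, a)) 0 + x) j = block x j.
  apply/colP => b; rewrite !mxE (can_eq (@mxtens_indexK N d)) xpair_eqE.
  by rewrite (negbTE ji) mulr0 add0r.
exact: subrr.
Qed.

End SeparableSum.

(** * Assembling the spectral and gradient estimates into the contraction factor *)

Section Contraction.
Context {R : realType} {N d : nat}.

Definition dsg_mean (W : 'M[R]_N) (alpha : R) (f : 'I_N -> 'cV[R]_d -> R)
    (x : 'cV[R]_(N * d)) : 'cV[R]_(N * d) :=
  tensmx W (1%:M : 'M[R]_d) *m x - alpha *: grad (separable_sum f) x.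

Lemma dsg_mean_lipschitz (mu L alpha : R) (f : 'I_N -> 'cV[R]_d -> R) (W : 'M[R]_N)
    (lam : seq R) (l : R) (x y : 'cV[R]_(N * d)) :
  mu <= L -> 0 <= alpha ->
  (forall i, strongly_convex mu (f i)) -> (forall i, lipschitz_gradient L (f i)) ->
  W^T = W -> doubly_stochastic W -> eigenvalue_list W lam ->
  (forall a, a \in lam -> l <= a) -> l <= 1 ->
  enorm (dsg_mean W alpha f y - dsg_mean W alpha f x) <= rate mu L l alpha * enorm (y - x).
Proof.
move=> muL a0 cf Lf Wsym Wds Wlam lmin l1.
set v := y - x; set F := separable_sum f.
have sector : enorm (grad F y - grad F x - ((mu + L) / 2) *: v)
    <= (L - mu) / 2 * enorm v.
  rewrite enorm_le; last lra.
  rewrite !sqr_enorm_block mulr_sumr ler_sum// => i _.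
  rewrite blockB blockZ !blockB !grad_separable_sum -enorm_le; last lra.
  exact: gradient_sector.
have mix := mixing_bound v Wsym Wds Wlam lmin l1.
pose b := (1 + l) / 2 - alpha * ((mu + L) / 2).
have -> : dsg_mean W alpha f y - dsg_mean W alpha f x
  = (tensmx W (1%:M : 'M[R]_d) *m v - ((1 + l) / 2) *: v)
    + (b *: v - alpha *: (grad F y - grad F x - ((mu + L) / 2) *: v)).
  rewrite /dsg_mean -/F opprB addrACA -opprB [- (_ - _)]opprB.
  have -> : tensmx W (1%:M : 'M[R]_d) *m v
    = tensmx W (1%:M : 'M[R]_d) *m y - tensmx W (1%:M : 'M[R]_d) *m x.
    by rewrite -mulmxBr.
  move: (tensmx _ _ *m y) (tensmx _ _ *m x) (grad F y) (grad F x) => ? ? ? ?.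
  by apply/colP => k; rewrite /b !mxE; field.
apply: le_trans (enorm_triangle _ _) _.
apply: le_trans (lerD mix (enorm_triangle _ _)) _.
rewrite enormN !enormZ (ger0_norm a0).
apply: (@le_trans _ _ (((1 - l) / 2 + `|b| + alpha * ((L - mu) / 2)) * enorm v)).
  have := ler_wpM2l a0 sector; lra.
rewrite ler_wpM2r ?enorm_ge0// /rate le_max.
(* The three constants add up to 1 - alpha mu when b >= 0 and to alpha L - l when b < 0, one for
   each entry of the maximum in [rate]. *)
have [b0|b0] := leP 0 b.
  rewrite (ger0_norm b0); apply/orP; left.
  have := ler_norm (1 - alpha * mu); apply: le_trans.
  by rewrite /b; lra.
rewrite (ltr0_norm b0); apply/orP; right.
rewrite -normrN; have := ler_norm (- (l - alpha * L)); apply: le_trans.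
by rewrite /b; lra.
Qed.

End Contraction.

(** * Integration against independent noise *)

Section Independence.
Context {R : realType} {dO : measure_display} {Omega : measurableType dO}.
Variable P : probability Omega R.

Definition indep_rv {d1 d2} {T1 : measurableType d1} {T2 : measurableType d2}
    (X : Omega -> T1) (Z : Omega -> T2) : Prop :=
  forall A B, measurable A -> measurable B ->
    (P (X @^-1` A `&` Z @^-1` B) = P (X @^-1` A) * P (Z @^-1` B))%E.

Lemma indep_rv_comp {d1 d2 d3} {T1 : measurableType d1} {T2 : measurableType d2}
    {T3 : measurableType d3} (X : Omega -> T1) (Z : Omega -> T2) (b : T1 -> T3) :
  measurable_fun setT b -> indep_rv X Z -> indep_rv (b \o X) Z.
Proof.
move=> mb XZ A B mA mB; rewrite comp_preimage XZ//.
by rewrite -[_ @^-1` _]setTI; exact: mb.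
Qed.

Section Law.
Context {d1 d2} {T1 : measurableType d1} {T2 : measurableType d2}.
Variables (X : {mfun Omega >-> T1}) (Z : {mfun Omega >-> T2}) (F : T1 * T2 -> R).
Hypotheses (XZ : indep_rv X Z) (mF : measurable_fun setT F).
Hypothesis iF : P.-integrable setT (fun o => (F (X o, Z o))%:E).
Local Open Scope ereal_scope.

Let mXZ : measurable_fun setT (fun o => (X o, Z o)).
Proof. by apply: measurable_fun_pair; exact: measurable_funPT. Qed.

Let V : {mfun Omega >-> (T1 * T2)%type} :=
  HB.pack (fun o => (X o, Z o)) (isMeasurableFun.Build _ _ _ _ _ mXZ).

(** A measure that agrees with the product measure on rectangles equals it, and on rectangles the
    agreement is independence. *)
Let distr_prod A : measurable A ->
  (distribution P X \x distribution P Z) A = distribution P V A.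
Proof. by move=> mA; apply: product_measure_unique. Qed.

Let mEF : measurable_fun setT (EFin \o F).
Proof. exact/measurable_EFinP. Qed.

Lemma indep_integrable :
  (distribution P X \x distribution P Z).-integrable setT (EFin \o F).
Proof.
apply/integrableP; split => //.
have /integrableP[_] := iF.
rewrite -[X in X < _](@ge0_integral_distribution _ _ _ _ _ P V
  (fun p => `|(F p)%:E|))//; last exact: measurableT_comp.
congr (_ < _); apply: eq_measure_integral => A mA _.
exact/esym/distr_prod.
Qed.

Lemma indep_integral :
  \int[P]_o (F (X o, Z o))%:E =
  \int[distribution P X]_x \int[distribution P Z]_z (F (x, z))%:E.
Proof.
have := integral12_prod_meas1 indep_integrable; rewrite /fubini_F /= => ->.
rewrite -(@integral_distribution _ _ _ _ _ P V _ mEF)//.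
by apply: eq_measure_integral => A mA _; exact/esym/distr_prod.
Qed.

End Law.

Local Open Scope ereal_scope.

(** The factor [phi] depends on all of [X], whereas centering is known only on events of b(X). By
    Fubini the integral is that of phi(x) M(b(x)) under the law of [X], and [M] vanishes almost
    surely. *)
Lemma indep_centered_integral {d1 d2 d3} {T1 : measurableType d1}
    {T2 : measurableType d2} {T3 : measurableType d3}
    (X : Omega -> T1) (Z : Omega -> T2) (b : T1 -> T3)
    (h : T3 * T2 -> R) (phi : T1 -> R) :
  measurable_fun setT X -> measurable_fun setT Z -> measurable_fun setT b ->
  measurable_fun setT h -> measurable_fun setT phi -> indep_rv X Z ->
  P.-integrable setT (fun o => (h (b (X o), Z o))%:E) ->
  (forall B, measurable B ->
    \int[P]_(o in (b \o X) @^-1` B) (h (b (X o), Z o))%:E = 0) ->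
  P.-integrable setT (fun o => (phi (X o) * h (b (X o), Z o))%:E) ->
  \int[P]_o (phi (X o) * h (b (X o), Z o))%:E = 0.
Proof.
move=> mX mZ mb mh mphi XZ ih h0 iphi.
pose X' : {mfun Omega >-> T1} := HB.pack X (isMeasurableFun.Build _ _ _ _ X mX).
pose Z' : {mfun Omega >-> T2} := HB.pack Z (isMeasurableFun.Build _ _ _ _ Z mZ).
have mY : measurable_fun setT (b \o X) by exact: measurableT_comp.
pose Y' : {mfun Omega >-> T3} := HB.pack (b \o X) (isMeasurableFun.Build _ _ _ _ _ mY).
have YZ : indep_rv Y' Z' := indep_rv_comp mb XZ.
(* M c is the mean of h (c, Z); it vanishes for almost every value c of b(X). *)
pose M c := \int[distribution P Z']_z (h (c, z))%:E.
have iM : (distribution P Y').-integrable setT M.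
  exact: (integrable_fubini_F (indep_integrable (X := Y') (Z := Z') YZ mh ih)).
have M0 : ae_eq (distribution P Y') setT M (cst 0).
  apply: integral_ae_eq => // E _ mE; rewrite integral0.
  (* With the indicator of [E] inside the integrand, Fubini identifies the integral of [M] over [E]
     with the integral of h(b(X), Z) over the event that b(X) lies in [E], which is 0. *)
  pose hE (p : T3 * T2) := (\1_E p.1 * h p)%R.
  have mhE : measurable_fun setT hE.
    apply: measurable_funM => //.
    have mE1 : measurable_fun setT (\1_E : T3 -> R) by exact: measurable_indic.
    exact: (measurableT_comp mE1 (@measurable_fst _ _ T3 T2)).
  have iE : P.-integrable setT (fun o => (hE (Y' o, Z' o))%:E).
    apply: le_integrable ih => //.
      apply/measurable_EFinP; apply: (measurableT_comp mhE).
      by apply: measurable_fun_pair => //; exact: measurable_funPT.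
    move=> o _; rewrite lee_fin /hE normrM indicE /=.
    by rewrite ger0_norm ?ler0n// ler_piMl// lern1 leq_b1.
  transitivity (\int[P]_o (hE (Y' o, Z' o))%:E).
    rewrite (indep_integral YZ mhE iE) integral_mkcond; apply: eq_integral => c _.
    rewrite patchE /hE /= indicE; case: ifPn => cE; rewrite ?(mem_set, memNset) //.
      by apply: eq_integral => z _; rewrite mul1r.
    by rewrite integral0_eq// => z _; rewrite mul0r.
  rewrite -[RHS](h0 E mE) [RHS]integral_mkcond; apply: eq_integral => o _.
  rewrite patchE /hE /= indicE.
  have -> : (o \in (b \o X) @^-1` E) = (b (X o) \in E) by apply/idP/idP; rewrite !inE.
  by case: ifPn => _; rewrite ?mul1r ?mul0r.
have mphiX : measurable_fun setT (fun p : T1 * T2 => phi p.1 * h (b p.1, p.2))%R.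
  apply: measurable_funM; first exact: (measurableT_comp mphi).
  apply: (measurableT_comp mh); apply: measurable_fun_pair => //.
  exact: (measurableT_comp mb).
have mhb : measurable_fun setT (fun p : T1 * T2 => h (b p.1, p.2))%R.
  apply: (measurableT_comp mh); apply: measurable_fun_pair => //.
  exact: (measurableT_comp mb).
rewrite (indep_integral (X := X') (Z := Z') XZ mphiX iphi).
rewrite -[RHS](integral0 (distribution P X') setT); apply: ae_eq_integral => //.
  exact: (measurable_fubini_F (indep_integrable (X := X') (Z := Z') XZ mphiX iphi)).
have /= ih1 := ae_integrable1 (indep_integrable (X := X') (Z := Z') XZ mhb ih).
(* The preimage under [b] of a null set for the law of b(X) is a null set for the law of [X]. *)
have M0b : {ae distribution P X', forall x, M (b x) = 0}.
  case: M0 => N [mN N0 MN]; exists (b @^-1` N); split.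
  - by rewrite -[_ @^-1` _]setTI; exact: mb.
  - by rewrite -N0.
  - by move=> x /= Mx; apply: MN => /= /(_ I).
near=> x => _ /=.
under eq_integral do rewrite EFinM.
rewrite integralZl//; last by near: x.
rewrite -/(M (b x)) (_ : M (b x) = 0) ?mule0//.
by near: x.
Unshelve. all: by end_near. Qed.

End Independence.

(** * Measurability of the iterates *)

Section Borel.
Context {R : realType}.

Lemma continuous_measurable_borel_cV n (f : 'cV[R]_n -> R) :
  continuous f -> measurable_fun setT (f : borel_cV R n -> R).
Proof.
move=> /continuousP cf; apply: (measurability _ (RGenOpens.measurableE R)).
move=> _ [_ [a [b ->]] <-]; rewrite setTI; apply: sub_sigma_algebra.
exact/cf/interval_open.
Qed.

Lemma measurable_coord n a :
  measurable_fun setT (fun x : borel_cV R n => (x : 'cV[R]_n) a 0).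
Proof. by apply: continuous_measurable_borel_cV; exact: coord_continuous. Qed.

(* An open set is the countable union of the boxes with rational center and
   radius 1/(k+1) that it contains. *)
Lemma measurable_to_borel_cV d (T : measurableType d) n (X : T -> 'cV[R]_n) :
  (forall a, measurable_fun setT (fun o => X o a 0)) ->
  measurable_fun setT (X : T -> borel_cV R n).
Proof.
move=> mX; have gen : @measurable _ (borel_cV R n) = <<s @open 'cV[R]_n >> by [].
apply: (measurability _ gen) => _ [U oU <-]; rewrite setTI.
pose box (i : 'cV[rat]_n * nat) : set 'cV[R]_n :=
  [set x | forall a, `|ratr (i.1 a 0) - x a 0| < i.2.+1%:R^-1].
pose F m := if unpickle m is Some i
            then [set o | box i `<=` U /\ box i (X o)] else set0.
have -> : X @^-1` U = \bigcup_m F m.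
  apply/seteqP; split => [ o Uo|o [m _]]; last first.
    by rewrite /F; case: unpickle => // i -[iU /iU].
  have /nbhs_ballP[e /= e0 eU] : nbhs (X o) U by exact: open_nbhs_nbhs.
  (* Two points of a box of radius 1/(k+1) differ by less than 2/(k+1) < e in each coordinate, so a
     box containing X(o) stays in the ball. *)
  have [k] : exists k, 0 + k.+1%:R^-1 < e / 2 :> R by apply/ltr_add_invr/divr_gt0.
  rewrite add0r => ke.
  have /choice[q qX] : forall a, exists q : rat,
      `|ratr q - X o a 0| < k.+1%:R^-1.
    move=> a; have /rat_in_itvoo[q] : X o a 0 < X o a 0 + k.+1%:R^-1 :> R.
      by rewrite ltrDl.
    rewrite in_itv /= => /andP[q1 q2]; exists q.
    by rewrite ger0_norm ?subr_ge0 1?ltW// ltrBlDl.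
  exists (pickle (\col_a q a, k)) => //; rewrite /F pickleK; split; last first.
    by move=> a /=; rewrite mxE.
  move=> y ybox; apply: eU; split => // a b; rewrite (ord1 b).
  rewrite /ball /= -(subrKA (ratr (q a))).
  apply: le_lt_trans (ler_normD _ _) _.
  have ke2 : k.+1%:R^-1 + k.+1%:R^-1 < e by rewrite [e]splitr; exact: ltrD.
  apply: lt_trans ke2; apply: ltrD; first by rewrite distrC; exact: qX.
  by have := ybox a; rewrite /= mxE.
apply: bigcupT_measurable => m; rewrite /F; case: unpickle => // i.
have [iU|niU] := pselect (box i `<=` U); last first.
  by rewrite (_ : [set _ | _] = set0)// -subset0 => o [].
have -> : [set o | box i `<=` U /\ box i (X o)] =
    ~` \bigcup_(a in [set: 'I_n]) (~` [set o | `|ratr (i.1 a 0) - X o a 0| < i.2.+1%:R^-1]).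
  rewrite setC_bigcup; apply/seteqP; split => o.
    by move=> [_ h] a _; rewrite setCK; exact: h.
  by move=> h; split=> // a; have := h a Logic.I; rewrite setCK.
apply: measurableC; apply: fin_bigcup_measurable => // a _; apply: measurableC.
rewrite -[X in measurable X]setTI.
have mf : measurable_fun setT (fun o => `|ratr (i.1 a 0) - X o a 0|).
  by apply: measurableT_comp => //; exact: measurable_funB.
have -> : [set o | `|ratr (i.1 a 0) - X o a 0| < i.2.+1%:R^-1] =
    (fun o => `|ratr (i.1 a 0) - X o a 0|) @^-1` `]-oo, i.2.+1%:R^-1[.
  by apply/seteqP; split => o /=; rewrite in_itv.
exact: mf.
Qed.

(** The crude factor n, in place of its square root, suffices for continuity. *)
Lemma enorm_le_mx_norm n (v : 'cV[R]_n) : enorm v <= n%:R * `|v|.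
Proof.
rewrite -(@ler_pXn2r _ 2)// ?nnegrE ?enorm_ge0 ?mulr_ge0//.
rewrite sqr_enorm exprMn.
apply: (@le_trans _ _ (\sum_(a < n) `|v| ^+ 2)).
  apply: ler_sum => a _; rewrite -[leLHS]real_normK ?num_real//.
  rewrite ler_pXn2r ?nnegrE//.
  by rewrite {2}/Num.norm /= mx_normrE; apply: (le_bigmax _ (fun i => `|v i.1 i.2|) (a, 0)).
rewrite sumr_const card_ord -[_ *+ n]mulr_natl ler_wpM2r ?sqr_ge0//.
rewrite -natrX ler_nat -mulnn; case: (n) => // m; exact: leq_pmulr.
Qed.

Lemma enorm_coord n (v : 'cV[R]_n) a : `|v a 0| <= enorm v.
Proof.
rewrite -(@ler_pXn2r _ 2)// ?nnegrE ?enorm_ge0//.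
rewrite sqr_enorm real_normK ?num_real// (bigD1 a)//= lerDl.
by apply: sumr_ge0 => b _; rewrite sqr_ge0.
Qed.

Lemma lipschitz_continuous_coord n (G : 'cV[R]_n -> 'cV[R]_n) L a :
  (forall x y, enorm (G x - G y) <= L * enorm (x - y)) ->
  continuous (fun x : 'cV[R]_n => G x a 0).
Proof.
(* [K] converts the Euclidean Lipschitz bound to the sup norm of the topology; the summand 1 keeps
   it positive. *)
move=> LG x; pose K := `|L| * n%:R + 1.
have K0 : 0 < K by rewrite ltr_wpDl// mulr_ge0.
apply/(@cvgrPdist_lt R R^o 'cV[R]_n (nbhs x) _) => e e0.
apply/nbhs_ballP; exists (e / K) => /=; first exact: divr_gt0.
move=> y; rewrite -ball_normE /= ltr_pdivlMr// mulrC => xy.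
apply: (@le_lt_trans _ _ (K * `|x - y|)) => //.
have := enorm_coord (G x - G y) a; rewrite !mxE => /le_trans; apply.
apply: le_trans (LG x y) _.
have := ler_norm L => /(ler_wpM2r (enorm_ge0 (x - y)))/le_trans; apply.
have := enorm_le_mx_norm (x - y) => /(ler_wpM2l (normr_ge0 L))/le_trans; apply.
by rewrite mulrA ler_wpM2r// lerDl.
Qed.

Lemma measurable_grad n (f : 'cV[R]_n -> R) L : lipschitz_gradient L f ->
  measurable_fun setT (grad f : borel_cV R n -> borel_cV R n).
Proof.
move=> [_ Lf]; apply: measurable_to_borel_cV => a.
exact: continuous_measurable_borel_cV (lipschitz_continuous_coord Lf).
Qed.

End Borel.

(** * Measurability of the iterates and their independence of the current noise *)

Section Dsg.
Context {R : realType} {N d : nat}.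

Lemma measurable_block i : measurable_fun setT
  (fun x : borel_cV R (N * d) => block x i : borel_cV R d).
Proof.
apply: measurable_to_borel_cV => a.
under eq_fun do rewrite mxE.
exact: measurable_coord.
Qed.

(** Measurability is asked only of the noise before step k, over any sigma-algebra on the sample
    space. This allows [dsg_indep_noise] to apply the lemma to the sigma-algebra of the other noise
    variables. *)
Lemma measurable_dsg (dO : measure_display) (Omega : measurableType dO)
    (dS : measure_display) (S : 'I_N -> measurableType dS)
    (w : forall i, nat -> Omega -> S i) (g : forall i, 'cV[R]_d -> S i -> 'cV[R]_d)
    (W : 'M[R]_N) (alpha : R) (x0 : 'cV[R]_(N * d)) k :
  (forall i, measurable_fun [set: borel_cV R d * S i]
       (fun p : borel_cV R d * S i => g i p.1 p.2 : borel_cV R d)) ->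
  (forall i t, (t < k)%N -> measurable_fun setT (w i t)) ->
  measurable_fun setT (dsg W alpha g w x0 k : Omega -> borel_cV R (N * d)).
Proof.
move=> mg; elim: k => [|k IH] mw /=; first exact: measurable_cst.
have {IH}mX := IH (fun i t tk => mw i t (leqW tk)).
apply: measurable_to_borel_cV => p; case: (mxtens_indexP p) => i a.
have E o : (tensmx W (1%:M : 'M[R]_d) *m dsg W alpha g w x0 k o
      - alpha *: stack (fun i => g i (block (dsg W alpha g w x0 k o) i) (w i k o)))
      (mxtens_index (i, a)) 0
    = (\sum_j W i j * dsg W alpha g w x0 k o (mxtens_index (j, a)) 0)
      - alpha * g i (block (dsg W alpha g w x0 k o) i) (w i k o) a 0.
  have /colP/(_ a) := block_tensmx W (dsg W alpha g w x0 k o) i.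
  rewrite [LHS]mxE summxE => h.
  rewrite mxE h mxE [_ (mxtens_index _) _]mxE [stack _ _ _]mxE mxtens_indexK /=.
  by congr (_ - _); apply: eq_bigr => j _; rewrite !mxE.
rewrite (_ : (fun o => _) = fun o => (\sum_j W i j * dsg W alpha g w x0 k o (mxtens_index (j, a)) 0)
      - alpha * g i (block (dsg W alpha g w x0 k o) i) (w i k o) a 0); last first.
  by apply/funext => o; exact: E.
apply: measurable_funB.
  apply: measurable_sum => j; apply: measurable_funM => //.
  exact: (measurableT_comp (measurable_coord _) mX).
apply: measurable_funM => //.
have mp : measurable_fun setT
    (fun o => (block (dsg W alpha g w x0 k o) i : borel_cV R d, w i k o)).
  apply: measurable_fun_pair; last exact: mw.
  exact: (measurableT_comp (measurable_block i) mX).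
exact: (measurableT_comp (measurable_coord a) (measurableT_comp (mg i) mp)).
Qed.

Lemma dsg_indep_noise (dO : measure_display) (Omega : measurableType dO)
    (P : probability Omega R)
    (dS : measure_display) (S : 'I_N -> measurableType dS)
    (w : forall i, nat -> Omega -> S i) (g : forall i, 'cV[R]_d -> S i -> 'cV[R]_d)
    (W : 'M[R]_N) (alpha : R) (x0 : 'cV[R]_(N * d)) i k :
  (forall i, measurable_fun [set: borel_cV R d * S i]
       (fun p : borel_cV R d * S i => g i p.1 p.2 : borel_cV R d)) ->
  independent_noise P w ->
  indep_rv P (dsg W alpha g w x0 k : Omega -> borel_cV R (N * d)) (w i k).
Proof.
(* [dsg] is unchanged when Omega carries only the sigma-algebra generated by the
   other noise variables, for which w_j^(t) with t < k is still measurable. *)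
move=> mg [mw wi] A B mA mB.
rewrite setIC (wi i k); first by rewrite muleC.
  by exists B => //; rewrite setTI.
pose G := [set E | exists j t, ((t < k)%N \/ (t = k /\ j <> i)) /\ sigma_gen (w j t) E].
pose w' j t (o : g_sigma_algebraType G) : S j := w j t o.
have := @measurable_dsg _ (g_sigma_algebraType G) _ S w' g W alpha x0 k mg.
move=> /(_ _ measurableT A mA); rewrite setTI; apply.
move=> j t tk _ C mC; apply: sub_sigma_algebra.
by exists j, t; split; [left|exists C].
Qed.

End Dsg.

(** * Second moments *)

Section Moments.
Context {R : realType} {dO : measure_display} {Omega : measurableType dO}.
Variable P : probability Omega R.
Implicit Types (f g : Omega -> R).

Lemma integrable_cst r : P.-integrable setT (fun _ => r%:E).
Proof. exact: finite_measure_integrable_cst. Qed.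

Lemma integral_cst_probability r : (\int[P]_o r%:E = r%:E)%E.
Proof.
by rewrite integral_cst// -[RHS]mule1; congr (_ * _)%E; exact: probability_setT.
Qed.

Lemma ae_le_integral_cst f r : P.-integrable setT (EFin \o f) -> 0 <= r ->
  {ae P, forall o, f o <= r} -> (\int[P]_o (f o)%:E <= r%:E)%E.
Proof.
move=> fi r0 [A [mA A0 fA]].
rewrite (negligible_integral mA)//.
apply: (@le_trans _ _ (\int[P]_(o in setT `\` A) r%:E)%E).
  apply: le_integral => //.
  - exact: measurableD.
  - by apply: integrableS fi => //; exact: measurableD.
  - by apply: (integrableS _ _ _ (integrable_cst r)) => //; exact: measurableD.
  - move=> o /set_mem[_ /= nA]; rewrite lee_fin leNgt; apply/negP => h.
    by apply: nA; apply: fA => /=; apply/negP; rewrite -ltNge.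
rewrite integral_cst//=; last exact: measurableD.
by rewrite -[leRHS]mule1 lee_wpmul2l ?lee_fin ?probability_le1//; exact: measurableD.
Qed.

Lemma measurable_sqr_enorm n (X : Omega -> 'cV[R]_n) c :
  measurable_fun setT (X : Omega -> borel_cV R n) ->
  measurable_fun setT (fun o => enorm (X o - c) ^+ 2).
Proof.
move=> mX; under eq_fun do rewrite sqr_enorm.
apply: measurable_sum => a; apply: measurable_funX.
under eq_fun do rewrite !mxE.
apply: measurable_funB => //; exact: measurableT_comp (measurable_coord a) mX.
Qed.

(** Domination: |X_a| <= |X - c| + |c_a| <= |X - c|^2 + 1 + |c_a|, since e <= e^2 + 1. *)
Lemma integrable_coord n (X : Omega -> 'cV[R]_n) c a :
  measurable_fun setT (X : Omega -> borel_cV R n) ->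
  P.-integrable setT (fun o => (enorm (X o - c) ^+ 2)%:E) ->
  P.-integrable setT (fun o => (X o a 0)%:E).
Proof.
move=> mX iX.
apply: (@le_integrable _ _ _ P setT measurableT _
  (fun o => (enorm (X o - c) ^+ 2)%:E + (1 + `|c a 0|)%:E)%E).
- apply/measurable_EFinP; exact: measurableT_comp (measurable_coord a) mX.
- move=> o _; rewrite -EFinD !abse_EFin lee_fin.
  have := enorm_coord (X o - c) a; rewrite !mxE => h.
  have := ler_normD (X o a 0 - c a 0) (c a 0); rewrite subrK.
  have e0 := enorm_ge0 (X o - c); have := normr_ge0 (c a 0).
  move: h; set e := enorm _ in e0 *.
  rewrite (_ : `|e ^+ 2 + _| = e ^+ 2 + (1 + `|c a 0|)); last first.
    by rewrite ger0_norm// addr_ge0 ?sqr_ge0// addr_ge0.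
  have := sqr_ge0 (e - 1); lra.
- exact: integrableD (integrable_cst _).
Qed.

Lemma variance_cV_le n (X : Omega -> 'cV[R]_n) c :
  measurable_fun setT (X : Omega -> borel_cV R n) ->
  P.-integrable setT (fun o => (enorm (X o - c) ^+ 2)%:E) ->
  (variance_cV P X <= \int[P]_o (enorm (X o - c) ^+ 2)%:E)%E.
Proof.
(* With m = E X: |X - m|^2 <= |X - c|^2 + 2 <c - m, X - m>, and the last term has
   mean 0. *)
move=> mX iX; rewrite /variance_cV unlock.
set m := expectation_cV P X.
have iXa a : P.-integrable setT (fun o => (X o a 0)%:E) by exact: integrable_coord iX.
have mE a : (\int[P]_o (X o a 0 - m a 0)%:E = 0)%E.
  rewrite (integralB_EFin measurableT (iXa a) (integrable_cst (m a 0))).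
  rewrite integral_cst_probability /m mxE unlock.
  by rewrite fineK ?subee// integrable_fin_num.
clearbody m; pose q a o := (2 * (c a 0 - m a 0)) * (X o a 0 - m a 0).
have iq a : P.-integrable setT (fun o => (q a o)%:E).
  have h := integrableB measurableT (iXa a) (integrable_cst (m a 0)).
  exact: integrableZl measurableT (2 * (c a 0 - m a 0)) _ h.
have iqs : P.-integrable setT (fun o => (\sum_a q a o)%:E).
  under eq_fun do rewrite -sumEFin.
  exact: integrable_sum.
have q0 : (\int[P]_o (\sum_a q a o)%:E = 0)%E.
  under eq_integral do rewrite -sumEFin.
  rewrite integral_sum//; apply: big1 => a _.
  have im : P.-integrable setT (fun o => (X o a 0 - m a 0)%:E).
    by have := integrableB measurableT (iXa a) (integrable_cst (m a 0)).
  have := integralZl measurableT im (2 * (c a 0 - m a 0)).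
  by rewrite mE mule0.
rewrite -[leRHS]adde0 -q0 -integralD_EFin//.
apply: ge0_le_integral => //.
- by move=> o _; rewrite lee_fin sqr_ge0.
- exact/measurable_EFinP/measurable_sqr_enorm.
- apply: emeasurable_funD; first exact: measurable_int iX.
  exact: measurable_int iqs.
- move=> o _; rewrite lee_fin !sqr_enorm -big_split /=.
  apply: ler_sum => a _; rewrite /q !mxE.
  (* The gap between the two sides is exactly (m_a - c_a)^2. *)
  have := sqr_ge0 (m a 0 - c a 0); lra.
Qed.

End Moments.

(** * One step of D-SG and the limit *)

(* Otherwise the agent index would become an implicit argument of [g] and [w]. *)
Unset Implicit Arguments.

Section Step.
Context {R : realType} {N d : nat} {L : R} {f : 'I_N -> 'cV[R]_d -> R}
  {W : 'M[R]_N} {dO : measure_display} {Omega : measurableType dO}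
  {P : probability Omega R} {dS : measure_display} {S : 'I_N -> measurableType dS}
  {w : forall i, nat -> Omega -> S i} {g : forall i, 'cV[R]_d -> S i -> 'cV[R]_d}
  {alpha sigma rho : R} {x0 xinf : 'cV[R]_(N * d)}.
Hypothesis f_smooth : forall i, lipschitz_gradient L (f i).
Hypothesis w_indep : independent_noise P w.
Hypothesis g_meas : forall i, measurable_fun [set: borel_cV R d * S i]
       (fun p : borel_cV R d * S i => g i p.1 p.2 : borel_cV R d).
Let x := dsg W alpha g w x0.
Hypothesis noise : gradient_noise P f g w x sigma.
Hypothesis xinf_fix : (1%:M - tensmx W (1%:M : 'M[R]_d)) *m xinf
                  + alpha *: grad (separable_sum f) xinf = 0.
Hypothesis contraction : forall z,
  enorm (dsg_mean W alpha f z - dsg_mean W alpha f xinf) <= rho * enorm (z - xinf).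

Let mx k : measurable_fun setT (x k : Omega -> borel_cV R (N * d)).
Proof. by apply: measurable_dsg => // i t _; exact: w_indep.1. Qed.

(** Written as a function of local state and noise sample, the error can serve as [h] in
    [indep_centered_integral]. *)
Let err i a (c : 'cV[R]_d) (s : S i) : R := g i c s a 0 - grad (f i) c a 0.

Let merr i a : measurable_fun [set: borel_cV R d * S i]
  (fun p : borel_cV R d * S i => err i a p.1 p.2).
Proof.
apply: measurable_funB; first exact: (measurableT_comp (measurable_coord a) (g_meas i)).
have h : measurable_fun [set: borel_cV R d] (fun c : borel_cV R d => grad (f i) c a 0).
  exact: (measurableT_comp (measurable_coord a) (measurable_grad (f_smooth i))).
exact: (measurableT_comp h measurable_fst).
Qed.

Let ierr k i a :
  P.-integrable setT (fun o => (err i a (block (x k o) i) (w i k o))%:E).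
Proof.
have [/(_ a)[iY _ iZ _] _] := noise i k.
exact: integrableB iY iZ.
Qed.

Let err_centered k i a (B : set (borel_cV R d)) : measurable B ->
  (\int[P]_(o in (fun o => block (x k o) i) @^-1` B)
     (err i a (block (x k o) i) (w i k o))%:E = 0)%E.
Proof.
move=> mB; have [/(_ a)[iY _ iZ YZ] _] := noise i k.
set A := _ @^-1` B.
have mA : measurable A.
  rewrite /A -[X in measurable X]setTI.
  exact: (measurableT_comp (measurable_block i) (mx k)).
have iYA := integrableS measurableT mA (@subsetT _ A) iY.
have iZA := integrableS measurableT mA (@subsetT _ A) iZ.
rewrite (integralB_EFin mA iYA iZA) YZ; last by exists B => //; rewrite setTI.
by rewrite subee// integrable_fin_num.
Qed.

Let ierr2 k i : P.-integrable setT
  (fun o => (enorm (g i (block (x k o) i) (w i k o) - grad (f i) (block (x k o) i)) ^+ 2)%:E).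
Proof. by have [_ [V [+ _ _ _] _]] := noise i k. Qed.

(** Testing the conditional expectation on the whole space replaces the squared error by its version
    [V], which is almost surely at most sigma^2. *)
Let err2_le k i : (\int[P]_o
  (enorm (g i (block (x k o) i) (w i k o) - grad (f i) (block (x k o) i)) ^+ 2)%:E
   <= (sigma ^+ 2)%:E)%E.
Proof.
have [_ [V [_ _ iV VE] Vs]] := noise i k.
rewrite VE; first exact: ae_le_integral_cst iV (sqr_ge0 _) Vs.
by exists setT => //; rewrite preimage_setT setTI.
Qed.

Let xinf_fixed : dsg_mean W alpha f xinf = xinf.
Proof.
move: xinf_fix; rewrite /dsg_mean mulmxBl mul1mx => /eqP.
by rewrite addrAC subr_eq0 => /eqP <-; rewrite addrK.
Qed.

Let mean_err o k : 'cV[R]_(N * d) := dsg_mean W alpha f (x k o) - xinf.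

Let noise_vec k o : 'cV[R]_(N * d) :=
  stack (fun i => g i (block (x k o) i) (w i k o)) - grad (separable_sum f) (x k o).

Let xS k o : x k.+1 o - xinf = mean_err o k - alpha *: noise_vec k o.
Proof.
rewrite /mean_err /dsg_mean /noise_vec /x /=.
by apply/colP => p; rewrite !mxE; ring.
Qed.

Let noise_vecE k o i a :
  noise_vec k o (mxtens_index (i, a)) 0 = err i a (block (x k o) i) (w i k o).
Proof.
have := grad_separable_sum f (x k o) i => /colP/(_ a) h.
by rewrite /err -h !mxE mxtens_indexK.
Qed.

Let noise_vec_sq k o : enorm (noise_vec k o) ^+ 2 =
  \sum_i enorm (g i (block (x k o) i) (w i k o) - grad (f i) (block (x k o) i)) ^+ 2.
Proof.
rewrite sqr_enorm_block; apply: eq_bigr => i _; congr (enorm _ ^+ 2).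
by rewrite /noise_vec blockB block_stack grad_separable_sum.
Qed.

Let inoise_vec k : P.-integrable setT (fun o => (enorm (noise_vec k o) ^+ 2)%:E).
Proof.
under eq_fun do rewrite noise_vec_sq -sumEFin.
exact: integrable_sum.
Qed.

Let noise_vec_le k :
  (\int[P]_o (enorm (noise_vec k o) ^+ 2)%:E <= (sigma ^+ 2 * N%:R)%:E)%E.
Proof.
under eq_integral do rewrite noise_vec_sq -sumEFin.
rewrite integral_sum//.
apply: (@le_trans _ _ (\sum_(i < N) (sigma ^+ 2)%:E)%E).
  by apply: lee_sum => i _; exact: err2_le.
by rewrite sumEFin sumr_const card_ord mulr_natr.
Qed.

Let mmean p : measurable_fun setT
  (fun z : borel_cV R (N * d) => (dsg_mean W alpha f z - xinf) p 0).
Proof.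
case: (mxtens_indexP p) => i a.
have E (z : 'cV[R]_(N * d)) : (dsg_mean W alpha f z - xinf) (mxtens_index (i, a)) 0
    = \sum_j W i j * z (mxtens_index (j, a)) 0 - alpha * grad (f i) (block z i) a 0
      - xinf (mxtens_index (i, a)) 0.
  have /colP/(_ a) := block_tensmx W z i.
  have /colP/(_ a) := grad_separable_sum f z i.
  rewrite mxE => h1; rewrite [LHS]mxE summxE => h2.
  have lin (A B C : 'cV[R]_(N * d)) r :
      (A - alpha *: B - C) r 0 = A r 0 - alpha * B r 0 - C r 0 by rewrite !mxE.
  rewrite lin h1 h2.
  by congr (_ - _ - _); apply: eq_bigr => j _; rewrite !mxE.
rewrite (_ : (fun z => _) = fun z : borel_cV R (N * d) =>
    \sum_j W i j * (z : 'cV_(N * d)) (mxtens_index (j, a)) 0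
    - alpha * grad (f i) (block z i) a 0 - xinf (mxtens_index (i, a)) 0); last first.
  by apply/funext => z; exact: E.
apply: measurable_funB => //; apply: measurable_funB.
  apply: measurable_sum => j; apply: measurable_funM => //.
  exact: measurable_coord.
apply: measurable_funM => //.
apply: measurableT_comp (measurable_coord a) _.
exact: (measurableT_comp (measurable_grad (f_smooth i)) (measurable_block i)).
Qed.

Let mean_err_le k o :
  enorm (mean_err o k) ^+ 2 <= rho ^+ 2 * enorm (x k o - xinf) ^+ 2.
Proof.
rewrite /mean_err -{1}xinf_fixed -exprMn.
rewrite ler_pXn2r ?nnegrE ?enorm_ge0//.
exact: le_trans (enorm_ge0 _) (contraction _).
Qed.

Section Induction.
Variable k : nat.
Hypothesis ix : P.-integrable setT (fun o => (enorm (x k o - xinf) ^+ 2)%:E).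

Let mmean_err2 : measurable_fun setT (fun o => enorm (mean_err o k) ^+ 2).
Proof.
under eq_fun do rewrite sqr_enorm.
apply: measurable_sum => p; apply: measurable_funX.
exact: (measurableT_comp (mmean p) (mx k)).
Qed.

Let imean : P.-integrable setT (fun o => (enorm (mean_err o k) ^+ 2)%:E).
Proof.
have h := integrableZl measurableT (rho ^+ 2) ix.
apply: le_integrable h => //; first exact/measurable_EFinP.
move=> o _; rewrite -EFinM lee_fin ger0_norm ?sqr_ge0//.
exact: le_trans (mean_err_le k o) (ler_norm _).
Qed.

(** Domination: |u_p v_p| <= |u| |v| <= |u|^2 + |v|^2, both integrable. *)
Let icross p : P.-integrable setT
  (fun o => (mean_err o k p 0 * noise_vec k o p 0)%:E).
Proof.
apply: (@le_integrable _ _ _ P setT measurableT _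
  (fun o => (enorm (mean_err o k) ^+ 2)%:E + (enorm (noise_vec k o) ^+ 2)%:E)%E).
- apply/measurable_EFinP; apply: measurable_funM.
    exact: (measurableT_comp (mmean p) (mx k)).
  case: (mxtens_indexP p) => i a.
  under eq_fun do rewrite noise_vecE.
  by have /measurable_EFinP := measurable_int _ (ierr k i a).
- move=> o _; rewrite -EFinD lee_fin.
  rewrite [leRHS]ger0_norm ?addr_ge0 ?sqr_ge0// normrM.
  have h1 := enorm_coord (mean_err o k) p; have h2 := enorm_coord (noise_vec k o) p.
  apply: le_trans (ler_pM (normr_ge0 _) (normr_ge0 _) h1 h2) _.
  have := sqr_ge0 (enorm (mean_err o k) - enorm (noise_vec k o)).
  have := sqr_ge0 (enorm (mean_err o k)); have := sqr_ge0 (enorm (noise_vec k o)).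
  move: (enorm _) (enorm _) => u v; lra.
- exact: integrableD.
Qed.

(** For p = (i, a), [indep_centered_integral] is used with the whole iterate as [X], [w i k] as [Z],
    the i-th block as [b], and the p-th coordinate of the mean step minus [xinf] as [phi]. *)
Let cross0 p : (\int[P]_o (mean_err o k p 0 * noise_vec k o p 0)%:E = 0)%E.
Proof.
have := icross p; case: (mxtens_indexP p) => i a.
under eq_fun do rewrite noise_vecE.
move=> ic.
exact: (indep_centered_integral (mx k) (w_indep.1 i k) (measurable_block i)
  (merr i a) (mmean (mxtens_index (i, a))) (dsg_indep_noise W alpha x0 k g_meas w_indep)
  (ierr k i a) (err_centered k i a) ic).
Qed.

Let sqr_xS o : enorm (x k.+1 o - xinf) ^+ 2 =
  enorm (mean_err o k) ^+ 2 + alpha ^+ 2 * enorm (noise_vec k o) ^+ 2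
  + (- (2 * alpha)) * \sum_p mean_err o k p 0 * noise_vec k o p 0.
Proof.
rewrite xS; move: (mean_err o k) (noise_vec k o) => u v.
rewrite -/(dotv u v) !sqr_enorm_dotv !dotvE (dotvC v u); ring.
Qed.

Let icrosses :
  P.-integrable setT (fun o => (\sum_p mean_err o k p 0 * noise_vec k o p 0)%:E).
Proof. by under eq_fun do rewrite -sumEFin; exact: integrable_sum. Qed.

Let crosses0 :
  (\int[P]_o (\sum_p mean_err o k p 0 * noise_vec k o p 0)%:E = 0)%E.
Proof.
by under eq_integral do rewrite -sumEFin; rewrite integral_sum// big1.
Qed.

Let noise_part o : \bar R := ((alpha ^+ 2)%:E * (enorm (noise_vec k o) ^+ 2)%:E)%E.
Let cross_part o : \bar R :=
  ((- (2 * alpha))%:E * (\sum_p mean_err o k p 0 * noise_vec k o p 0)%:E)%E.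

Let inoise_part : P.-integrable setT noise_part.
Proof. by have := integrableZl measurableT (alpha ^+ 2) (inoise_vec k). Qed.

Let icross_part : P.-integrable setT cross_part.
Proof. by have := integrableZl measurableT (- (2 * alpha)) icrosses. Qed.

Let sqr_xS_split : (fun o => (enorm (x k.+1 o - xinf) ^+ 2)%:E) =
  ((fun o => (enorm (mean_err o k) ^+ 2)%:E) \+ noise_part \+ cross_part)%E.
Proof. by apply/funext => o; rewrite sqr_xS !EFinD (EFinM (alpha ^+ 2)) (EFinM (- _)). Qed.

Lemma integrable_dsgS :
  P.-integrable setT (fun o => (enorm (x k.+1 o - xinf) ^+ 2)%:E).
Proof. by rewrite sqr_xS_split; apply: integrableD => //; exact: integrableD. Qed.

Lemma integral_dsgS_le :
  (\int[P]_o (enorm (x k.+1 o - xinf) ^+ 2)%:E <=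
   (rho ^+ 2)%:E * \int[P]_o (enorm (x k o - xinf) ^+ 2)%:E
   + (sigma ^+ 2 * alpha ^+ 2 * N%:R)%:E)%E.
Proof.
rewrite sqr_xS_split integralD//; last exact: integrableD.
rewrite integralD// [X in (_ + X + _)%E]integralZl; [|by []|exact: inoise_vec].
rewrite [X in (_ + X)%E]integralZl; [|by []|exact: icrosses].
rewrite crosses0 mule0 adde0.
apply: leeD.
  rewrite -integralZl//; apply: le_integral => //; first exact: integrableZl.
  by move=> o _; rewrite -EFinM lee_fin.
apply: le_trans (lee_wpmul2l _ (noise_vec_le k)) _; first by rewrite lee_fin sqr_ge0.
by rewrite -EFinM lee_fin mulrCA mulrA.
Qed.

End Induction.

(** Integrability travels with the bound through the induction, because the one-step estimate at k
    relies on it. *)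
Lemma dsg_second_moment k : rho ^+ 2 < 1 ->
  P.-integrable setT (fun o => (enorm (x k o - xinf) ^+ 2)%:E) /\
  (\int[P]_o (enorm (x k o - xinf) ^+ 2)%:E <=
          (rho ^+ (2 * k) * enorm (x0 - xinf) ^+ 2
            + (1 - rho ^+ (2 * k)) / (1 - rho ^+ 2)
              * (sigma ^+ 2 * alpha ^+ 2 * N%:R))%:E)%E.
Proof.
move=> rho1; elim: k => [|k [ik bk]].
  split; first exact: (integrable_cst P (enorm (x0 - xinf) ^+ 2)).
  rewrite [leLHS](integral_cst_probability P (enorm (x0 - xinf) ^+ 2)).
  by rewrite muln0 expr0 mul1r subrr !mul0r addr0.
split; first exact: integrable_dsgS.
apply: le_trans (integral_dsgS_le k ik) _.
apply: (le_trans (leeD (lee_wpmul2l _ bk) (lexx _))).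
  by rewrite lee_fin sqr_ge0.
(* The recursion closes with equality: with r = rho^(2k), rho^2 (1 - r)/(1 - rho^2) + 1 = (1 - rho^2
   r)/(1 - rho^2). *)
rewrite -EFinM -EFinD lee_fin le_eqVlt; apply/orP; left; apply/eqP.
rewrite mulnS exprD.
have : 1 - rho ^+ 2 != 0 by rewrite gt_eqF// subr_gt0.
move: (rho ^+ (2 * k)) => r ?; field.
by [].
Qed.

End Step.

(** * Limit superior of geometrically bounded sequences *)

Lemma le_limn_esup (R : realType) (u v : (\bar R)^nat) :
  (forall n, (u n <= v n)%E) -> (limn_esup u <= limn_esup v)%E.
Proof.
move=> uv; rewrite !limn_esup_lim; apply: lee_lim; [exact: is_cvg_esups..|].
apply: nearW => n; apply: ub_ereal_sup => _ [m /= nm <-].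
by apply: le_trans (uv m) _; apply: ereal_sup_ubound; exists m.
Qed.

Lemma limn_esup_geometric_le (R : realType) (u : (\bar R)^nat) (rho a b : R) :
  0 <= rho < 1 -> (forall n, (u n <= (rho ^+ (2 * n) * a + (1 - rho ^+ (2 * n)) * b)%:E)%E) ->
  (limn_esup u <= b%:E)%E.
Proof.
move=> /andP[r0 r1] /le_limn_esup/le_trans -> //.
have r2 : `|rho ^+ 2| < 1 by rewrite ger0_norm ?exprn_ge0// expr_lt1.
have cr : (fun n => rho ^+ (2 * n)) @ \oo --> (0 : R).
  by under eq_fun do rewrite exprM; exact: cvg_expr.
have cv : (fun n => rho ^+ (2 * n) * a + (1 - rho ^+ (2 * n)) * b) @ \oo --> b.
  have cst (c : R) : (fun _ : nat => c) @ \oo --> c by exact: cvg_cst.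
  have := cvgD (cvgM cr (cst a)) (cvgM (cvgB (cst 1) cr) (cst b)).
  by rewrite mul0r subr0 mul1r add0r; apply.
have : (fun n => (rho ^+ (2 * n) * a + (1 - rho ^+ (2 * n)) * b)%:E) @ \oo --> b%:E.
  by apply: cvg_EFin => //; exact: nearW.
by move=> /cvg_limn_einf_sup[_ ->].
Qed.

Theorem theorem1 (R : realType) (N d : nat) (N_gt0 : (0 < N)%N)
    (mu L : R) (mu_gt0 : 0 < mu) (mu_le_L : mu <= L)
    (f : 'I_N -> 'cV[R]_d -> R)
    (f_convex : forall i, strongly_convex mu (f i))
    (f_smooth : forall i, lipschitz_gradient L (f i))
    (e : rel 'I_N) (e_graph : connected_graph e)
    (W : 'M[R]_N) (W_mixing : mixing_matrix e W)
    (lam : seq R) (W_lam : eigenvalue_list W lam)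
    (dO : measure_display) (Omega : measurableType dO) (P : probability Omega R)
    (dS : measure_display) (S : 'I_N -> measurableType dS)
    (w : forall i, nat -> Omega -> S i) (w_indep : independent_noise P w)
    (g : forall i, 'cV[R]_d -> S i -> 'cV[R]_d)
    (g_meas : forall i, measurable_fun [set: borel_cV R d * S i]
       (fun p : borel_cV R d * S i => g i p.1 p.2 : borel_cV R d))
    (alpha : R) (alpha_gt0 : 0 < alpha)
    (alpha_lt : alpha < (1 + lam`_N.-1) / L)
    (x0 : 'cV[R]_(N * d))
    (sigma : R) (sigma_ge0 : 0 <= sigma)
    (noise : gradient_noise P f g w (dsg W alpha g w x0) sigma)
    (xinf : 'cV[R]_(N * d))
    (xinf_fix : (1%:M - tensmx W (1%:M : 'M[R]_d)) *m xinf
                  + alpha *: grad (separable_sum f) xinf = 0) :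
  let x := dsg W alpha g w x0 in
  let rho := rate mu L lam`_N.-1 alpha in
  [/\ 0 <= rho < 1,
      forall k : nat,
        ('E_P[fun o => (enorm (x k o - xinf) ^+ 2)%R] <=
          (rho ^+ (2 * k) * enorm (x0 - xinf) ^+ 2
            + (1 - rho ^+ (2 * k)) / (1 - rho ^+ 2)
              * (sigma ^+ 2 * alpha ^+ 2 * N%:R))%:E)%E &
      0 < sigma ->
        (robustness P sigma x <= (alpha ^+ 2 / (1 - rho ^+ 2))%:E)%E].
Proof.
have [Wsym Wds _ _] := W_mixing.
have [lmem lmin] := eigenvalue_list_min N_gt0 W_lam.
set l := lam`_N.-1 in alpha_lt lmem lmin *.
move=> x rho.
have l_le1 : l <= 1.
  apply: le_trans (ler_norm _) (doubly_stochastic_eigenvalue_le1 Wds _).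
  by rewrite (eigenvalue_listP W_lam).
have L_gt0 : 0 < L by apply: lt_le_trans mu_le_L.
have aL : alpha * L < 1 + l by rewrite -ltr_pdivlMr.
have amu0 : 0 < alpha * mu by apply: mulr_gt0.
have amuL : alpha * mu <= alpha * L by rewrite ler_pM2l.
(* From 0 < alpha mu <= alpha L < 1 + l <= 2, both 1 - alpha mu and l - alpha L lie strictly between
   -1 and 1. *)
have rho01 : 0 <= rho < 1.
  rewrite /rho /rate le_max normr_ge0 /= gt_max !ltr_norml.
  by apply/andP; split; apply/andP; split; lra.
have /andP[rho0 rho1] := rho01.
have rho2 : rho ^+ 2 < 1 by rewrite expr_lt1.
have contr z : enorm (dsg_mean W alpha f z - dsg_mean W alpha f xinf)
    <= rho * enorm (z - xinf).
  exact: (dsg_mean_lipschitz _ _ mu_le_L (ltW alpha_gt0) f_convex f_smooth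
    Wsym Wds W_lam lmin l_le1).
have mom k := dsg_second_moment f_smooth w_indep g_meas noise xinf_fix contr k rho2.
split=> // [k|sigma_gt0]; first by rewrite unlock; exact: (mom k).2.
have c_gt0 : 0 < sigma ^+ 2 * N%:R by rewrite mulr_gt0 ?exprn_gt0 ?ltr0n.
have mx k : measurable_fun setT (x k : Omega -> borel_cV R (N * d)).
  by apply: measurable_dsg => // i t _; exact: w_indep.1.
have lim_le : (limn_esup (fun k => variance_cV P (x k)) <=
    ((sigma ^+ 2 * alpha ^+ 2 * N%:R) / (1 - rho ^+ 2))%:E)%E.
  apply: (@limn_esup_geometric_le _ _ rho (enorm (x0 - xinf) ^+ 2) _ rho01) => k.
  have [ik bk] := mom k.
  (* The variance is at most the mean square distance to the fixed vector [xinf], which the moment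
     bound controls. *)
  apply: le_trans (variance_cV_le (mx k) ik) _.
  apply: le_trans bk _; rewrite lee_fin le_eqVlt; apply/orP; left; apply/eqP.
  by congr (_ + _); rewrite -[LHS]mulrA; congr (_ * _); rewrite mulrC.
rewrite /robustness.
apply: (@le_trans _ _ (((sigma ^+ 2 * N%:R)^-1)%:E *
  ((sigma ^+ 2 * alpha ^+ 2 * N%:R) / (1 - rho ^+ 2))%:E)%E).
  by rewrite lee_pmul2l ?lte_fin ?invr_gt0.
rewrite -EFinM lee_fin le_eqVlt; apply/orP; left; apply/eqP.
have : 1 - rho ^+ 2 != 0 by rewrite gt_eqF// subr_gt0.
have : sigma != 0 by rewrite gt_eqF.
have : N%:R != 0 :> R by rewrite pnatr_eq0 -lt0n.
move: (rho ^+ 2) => r ? ? ?; field.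
by apply/and3P.
Qed.
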